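(* Let $N \geq 1$ be an integer, let $a < b$ be real numbers, and let $\mathcal{C} = \mathcal{C}([a,b],\mathbb{R}^N)$ be the space of continuous $\mathbb{R}^N$-valued maps on $[a,b]$. Let $\mathcal{F} \subset \mathcal{C}$ be uniformly bounded. Then $$\frac{1}{2}\, \mu_{\mathrm{uec}}(\mathcal{F}) \leq \mu_{\mathrm{H}}(\mathcal{F}) \leq \left(\frac{N}{2N+2}\right)^{1/2} \mu_{\mathrm{uec}}(\mathcal{F}).$$ In particular, if $N = 1$, then $$\mu_{\mathrm{H}}(\mathcal{F}) = \frac{1}{2}\, \mu_{\mathrm{uec}}(\mathcal{F}).$$
   Context: $|\cdot|$ denotes the Euclidean norm on $\mathbb{R}^N$, and $\|f\|_\infty = \sup_{x \in [a,b]} |f(x)|$ is the supremum norm on $\mathcal{C}$. A set $\mathcal{F} \subset \mathcal{C}$ is uniformly bounded if there exists a constant $M > 0$ such that $|f(x)| \leq M$ for all $f \in \mathcal{F}$ and all $x \in [a,b]$. For a uniformly bounded set $\mathcal{F} \subset \mathcal{C}$, the Hausdorff measure of noncompactness is $$\mu_{\mathrm{H}}(\mathcal{F}) = \inf_{\mathcal{F}_0} \sup_{f \in \mathcal{F}} \inf_{g \in \mathcal{F}_0} \|f - g\|_\infty,$$ where the first infimum runs through all finite sets $\mathcal{F}_0 \subset \mathcal{C}$ (the elements of $\mathcal{F}_0$ need not belong to $\mathcal{F}$). For a uniformly bounded set $\mathcal{F} \subset \mathcal{C}$, the measure of non-uniform equicontinuity is $$\mu_{\mathrm{uec}}(\mathcal{F})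 = \inf_{\delta > 0} \sup_{f \in \mathcal{F}} \sup_{|x-y| < \delta} |f(x) - f(y)|,$$ where the second supremum runs through all $x, y \in [a,b]$ with $|x - y| < \delta$. All suprema and infima are taken in $[0,\infty]$ (so an infimum over the empty set is $+\infty$ and a supremum over the empty set is $0$). *)

(* Defs.v *)
From HB Require Import structures.
From mathcomp Require Import all_boot all_order all_algebra.
From mathcomp Require Import all_classical all_reals all_analysis.

Set Implicit Arguments.
Unset Strict Implicit.
Unset Printing Implicit Defensive.

Import Order.TTheory GRing.Theory Num.Theory.
Import numFieldNormedType.Exports.

Local Open Scope classical_set_scope.
Local Open Scope ring_scope.

(* The library norm on row vectors is the max norm; only its topology, which is
   also the Euclidean one, is used (through [within ... continuous]). *)
Definition enorm (R : realType) (N : nat) (v : 'rV[R]_N) : R :=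
  Num.sqrt (\sum_(i < N) v ord0 i ^+ 2).

(* Supremum in [0, +oo]: it is 0 on the empty set, where [ereal_sup] is -oo.
   The infimum in [0, +oo] is [ereal_inf], which is +oo on the empty set. *)
Definition nnsup (R : realType) (S : set (\bar R)) : \bar R :=
  ereal_sup (0%E |` S).

(* Elements of C([a,b], R^N) are represented by functions on R that are
   continuous on the subspace [a,b]; their values outside [a,b] are arbitrary
   and are never used by the notions below. *)
Definition Cab (R : realType) (N : nat) (a b : R) : set (R -> 'rV[R]_N) :=
  [set f | {within `[a, b], continuous f}].

Definition supnorm (R : realType) (N : nat) (a b : R) (f : R -> 'rV[R]_N) :
    \bar R :=
  nnsup [set (enorm (f x))%:E | x in `[a, b]].

Definition uniformly_bounded (R : realType) (N : nat) (a b : R)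
    (F : set (R -> 'rV[R]_N)) : Prop :=
  exists M : R, 0 < M /\
    forall f, F f -> forall x, x \in `[a, b] -> enorm (f x) <= M.

Definition mu_H (R : realType) (N : nat) (a b : R)
    (F : set (R -> 'rV[R]_N)) : \bar R :=
  ereal_inf
    [set nnsup
       [set ereal_inf [set supnorm a b (fun x => f x - g x) | g in F0]
       | f in F]
    | F0 in [set F0 | finite_set F0 /\ F0 `<=` @Cab R N a b]].

Definition mu_uec (R : realType) (N : nat) (a b : R)
    (F : set (R -> 'rV[R]_N)) : \bar R :=
  ereal_inf
    [set nnsup
       [set nnsup
          [set (enorm (f p.1 - f p.2))%:E
          | p in [set p : R * R | [/\ p.1 \in `[a, b], p.2 \in `[a, b]
                                    & `|p.1 - p.2| < delta]]]
       | f in F]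
    | delta in [set delta : R | 0 < delta]].

(* Main.v *)
Require Import Defs.
From HB Require Import structures.
From mathcomp Require Import all_boot all_order all_algebra.
From mathcomp Require Import all_classical all_reals all_analysis.
From mathcomp Require Import ring lra.

(** The lower bound is the triangle inequality: a function within [r] of a
    member [g] of a finite set of continuous functions oscillates by at most
    [2 r] more than [g] does, and a finite set of continuous functions on
    a segment is uniformly equicontinuous ([finite_equicontinuous]).

    The upper bound rests on Jung's theorem ([jung]): a set of diameter [D] in
    R^N lies in a ball of radius [J D], where [J ^ 2 = N / (2 N + 2)].  If every
    [f] in [F] oscillates by at most [w] on distances below [d], cover [a,b]
    by intervals of radius [d / 2].  The values of [f] on the [i]-th interval
    have diameter at most [w], so they lie in a ball of radius [J w] with some
    centre [c_i].  Blend the [c_i] by a partition of unity subordinate to the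
    cover: at each [x] the result is a convex combination of centres that are
    all within [J w] of [f x], so the blend is within [J w] of [f] everywhere.
    To have finitely many blends for all [f] together, the values of [f] are
    first rounded to a finite [e]-net of a ball containing them all; the centre
    then depends only on a subset of this net, and the price is an error that
    vanishes with [e] ([finite_jung_net]).

    Jung's theorem is needed only for finite sets of points [p_i].  Choose
    weights [l_i] on the simplex maximising the variance
    [sum l_i |p_i|^2 - |sum l_i p_i|^2], and let [c] be the barycentre.
    Maximality says that the ball around [c] whose squared radius is the
    maximal variance [Q] contains all [p_i] ([max_variance_barycenter]).  With
    [u_i = p_i - c], the matrix [M = sum l_i u_i u_i^T] has trace [Q], so
    [Q ^ 2 <= N tr (M ^ 2) = N sum l_i l_j <u_i, u_j>^2]; the diameter bound
    controls the inner products from below, and this turns into the bound on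
    [Q] ([balanced_radius_le]).  For [N = 1] both constants are [1 / 2]. *)

Import Order.TTheory GRing.Theory Num.Theory.
Import numFieldNormedType.Exports.

Local Open Scope classical_set_scope.
Local Open Scope ring_scope.

(** * Euclidean geometry of row vectors *)

Definition dot {R : realType} {N : nat} (u v : 'rV[R]_N) : R :=
  \sum_(k < N) u ord0 k * v ord0 k.

Section Euclidean.
Context {R : realType} {N : nat}.
Implicit Types (u v w : 'rV[R]_N) (c : R).

Lemma dotC u v : dot u v = dot v u.
Proof. by apply: eq_bigr => k _; rewrite mulrC. Qed.

Lemma dotDl u v w : dot (u + v) w = dot u w + dot v w.
Proof. by rewrite -big_split; apply: eq_bigr => k _; rewrite !mxE mulrDl. Qed.

Lemma dotZl c u v : dot (c *: u) v = c * dot u v.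
Proof. by rewrite mulr_sumr; apply: eq_bigr => k _; rewrite !mxE mulrA. Qed.

Lemma dotNl u v : dot (- u) v = - dot u v.
Proof. by rewrite -scaleN1r dotZl mulN1r. Qed.

Lemma dotDr u v w : dot u (v + w) = dot u v + dot u w.
Proof. by rewrite dotC dotDl !(dotC u). Qed.

Lemma dotZr c u v : dot u (c *: v) = c * dot u v.
Proof. by rewrite dotC dotZl dotC. Qed.

Lemma dotNr u v : dot u (- v) = - dot u v.
Proof. by rewrite dotC dotNl dotC. Qed.

Definition dotE := (dotDl, dotDr, dotZl, dotZr, dotNl, dotNr).

Lemma dot_suml (T : finType) (x : T -> 'rV[R]_N) v :
  dot (\sum_i x i) v = \sum_i dot (x i) v.
Proof.
rewrite /dot exchange_big; apply: eq_bigr => k _.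
by rewrite summxE mulr_suml.
Qed.

Lemma dot_sumr (T : finType) (x : T -> 'rV[R]_N) v :
  dot v (\sum_i x i) = \sum_i dot v (x i).
Proof. by rewrite dotC dot_suml; apply: eq_bigr => i _; rewrite dotC. Qed.

Lemma dot_ge0 u : 0 <= dot u u.
Proof. by apply: sumr_ge0 => k _; rewrite -expr2 sqr_ge0. Qed.

Lemma enormE u : enorm u = Num.sqrt (dot u u).
Proof. by rewrite /enorm /dot; under eq_bigr do rewrite expr2. Qed.

Lemma enorm_ge0 u : 0 <= enorm u.
Proof. exact: sqrtr_ge0. Qed.

Lemma sqr_enorm u : enorm u ^+ 2 = dot u u.
Proof. by rewrite enormE sqr_sqrtr ?dot_ge0. Qed.

Lemma enorm_leP u c : 0 <= c -> (enorm u <= c) = (dot u u <= c ^+ 2).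
Proof.
by move=> c0; rewrite -sqr_enorm ler_pXn2r ?nnegrE ?enorm_ge0.
Qed.

Lemma enormZ c u : enorm (c *: u) = `|c| * enorm u.
Proof.
by rewrite !enormE !dotE mulrA -expr2 sqrtrM ?sqr_ge0 // sqrtr_sqr.
Qed.

Lemma enorm0 : enorm (0 : 'rV[R]_N) = 0.
Proof. by rewrite -(scale0r 0) enormZ normr0 mul0r. Qed.

Lemma enormN u : enorm (- u) = enorm u.
Proof. by rewrite -scaleN1r enormZ normrN1 mul1r. Qed.

Lemma enormB u v : enorm (u - v) = enorm (v - u).
Proof. by rewrite -enormN opprB. Qed.

Lemma enorm_eq0 u : enorm u = 0 -> u = 0.
Proof.
move=> u0; have : dot u u = 0 by rewrite -sqr_enorm u0 expr0n.
move/psumr_eq0P => duu; apply/rowP => k; rewrite mxE.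
have /eqP : u ord0 k * u ord0 k = 0.
  by apply: duu => // l _; rewrite -expr2 sqr_ge0.
by rewrite mulf_eq0 orbb => /eqP.
Qed.

Lemma dot_le u v : dot u v <= enorm u * enorm v.
Proof.
have dot0l w : dot 0 w = 0 by rewrite -(scale0r 0) dotZl mul0r.
have [/enorm_eq0 ->|u0] := eqVneq (enorm u) 0.
  by rewrite dot0l enorm0 mul0r.
have [/enorm_eq0 ->|v0] := eqVneq (enorm v) 0.
  by rewrite dotC dot0l enorm0 mulr0.
have up : 0 < enorm u by rewrite lt_def u0 enorm_ge0.
have vp : 0 < enorm v by rewrite lt_def v0 enorm_ge0.
have := dot_ge0 (enorm v *: u - enorm u *: v).
rewrite !dotE -!sqr_enorm (dotC v u).
set x := enorm u in up *; set y := enorm v in vp *; set d := dot u v => h.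
have : 0 <= (x * y) * (x * y - d) by nra.
by rewrite pmulr_rge0 ?mulr_gt0 // subr_ge0.
Qed.

Lemma enormD u v : enorm (u + v) <= enorm u + enorm v.
Proof.
rewrite enorm_leP ?addr_ge0 ?enorm_ge0 // !dotE (dotC v u) -!sqr_enorm.
have := dot_le u v; lra.
Qed.

Lemma enorm_sum (T : finType) (x : T -> 'rV[R]_N) :
  enorm (\sum_i x i) <= \sum_i enorm (x i).
Proof.
elim/big_ind2 : _ => [|u c v d uc vd|//]; first by rewrite enorm0.
by apply: (le_trans (enormD _ _)); exact: lerD.
Qed.

Lemma enorm_distD w u v : enorm (u - v) <= enorm (u - w) + enorm (w - v).
Proof. by rewrite -{1}(subrK w u) -addrA enormD. Qed.

Lemma enorm_le_coord u c :
  0 <= c -> (forall k, `|u ord0 k| <= c) -> enorm u <= N%:R * c.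
Proof.
move=> c0 uc; rewrite enorm_leP ?mulr_ge0 //.
apply: (@le_trans _ _ (\sum_(k < N) c ^+ 2)).
  apply: ler_sum => k _; rewrite -expr2 -(real_normK (num_real (u _ _))).
  by rewrite ler_pXn2r ?nnegrE.
rewrite sumr_const card_ord exprMn -[leLHS]mulr_natl ler_wpM2r ?sqr_ge0 //.
by rewrite expr2 -natrM ler_nat; case: (N) => // n; rewrite leq_pmull.
Qed.
End Euclidean.

(** * Jung's theorem *)

(** Expand [sum (N x_k - S) ^ 2 >= 0], where [S] is the sum of the [x_k]. *)
Lemma sqr_sum_le (R : realType) (N : nat) (x : 'I_N -> R) :
  (\sum_k x k) ^+ 2 <= N%:R * \sum_k x k ^+ 2.
Proof.
case: N x => [|n] x; first by rewrite !big_ord0 expr0n mul0r.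
set S := \sum_k x k; set Q := \sum_k x k ^+ 2.
have : 0 <= \sum_k (n.+1%:R * x k - S) ^+ 2.
  by apply: sumr_ge0 => k _; exact: sqr_ge0.
have -> : \sum_k (n.+1%:R * x k - S) ^+ 2 = n.+1%:R * (n.+1%:R * Q - S ^+ 2).
  have -> : \sum_k (n.+1%:R * x k - S) ^+ 2 =
      \sum_k (n.+1%:R ^+ 2 * x k ^+ 2 - 2 * n.+1%:R * S * x k + S ^+ 2).
    by apply: eq_bigr => k _; ring.
  rewrite big_split sumrB /= -!mulr_sumr sumr_const card_ord -/Q -/S.
  by rewrite -[S *+ _]mulr_natl; ring.
by rewrite pmulr_rge0 // subr_ge0.
Qed.

(** The dimension enters through [tr (M ^ 2) >= (tr M) ^ 2 / N] for the
    [N]-by-[N] matrix [M] of second moments.  It replaces the usual reduction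
    to [N + 1] contact points by Caratheodory's theorem. *)
Lemma balanced_radius_le (R : realType) (N : nat) (T : finType) (l : T -> R)
    (u : T -> 'rV[R]_N) (Q E : R) :
  (forall i, 0 <= l i) -> \sum_i l i = 1 -> \sum_i l i *: u i = 0 ->
  \sum_i l i * dot (u i) (u i) = Q -> (forall i, dot (u i) (u i) <= Q) ->
  (forall i j, dot (u i - u j) (u i - u j) <= E) ->
  (2 * N%:R + 2) * Q <= N%:R * E.
Proof.
move=> l0 l1 lu lQ uQ uE.
have Q0 : 0 <= Q by rewrite -lQ sumr_ge0 // => i _; rewrite mulr_ge0 ?dot_ge0.
have E0 : 0 <= E.
  have [i _|T0] := pickP (@predT T); first exact: le_trans (dot_ge0 _) (uE i i).
  by move: l1; rewrite big_pred0 // => /eqP; rewrite eq_sym oner_eq0.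
(* Complementary slackness: only points on the sphere carry weight. *)
have contact i : l i != 0 -> dot (u i) (u i) = Q.
  move=> li; have : \sum_j l j * (Q - dot (u j) (u j)) = 0.
    under eq_bigr do rewrite mulrBr.
    by rewrite sumrB -mulr_suml l1 lQ mul1r subrr.
  move/psumr_eq0P => /(_ _ i isT) => H.
  have /eqP : l i * (Q - dot (u i) (u i)) = 0.
    by apply: H => j _; rewrite mulr_ge0 // subr_ge0.
  by rewrite mulf_eq0 (negbTE li) /= subr_eq0 => /eqP.
(* For points on the sphere, <u_i, u_j> lies between -s and Q. *)
pose s := E / 2 - Q.
have pair_ge0 i j :
    0 <= l i * l j * ((dot (u i) (u j) + s) * (Q - dot (u i) (u j))).
  have [->|li] := eqVneq (l i) 0; first by rewrite !mul0r.
  have [->|lj] := eqVneq (l j) 0; first by rewrite mulr0 mul0r.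
  have := uE i j; have := dot_ge0 (u i - u j).
  rewrite !dotE (dotC (u j)) !contact // /s => h1 h2.
  by apply: mulr_ge0; [exact: mulr_ge0|apply: mulr_ge0; lra].
pose M k k' := \sum_i l i * (u i ord0 k * u i ord0 k').
have MT : \sum_k \sum_k' M k k' ^+ 2 =
    \sum_i \sum_j l i * l j * dot (u i) (u j) ^+ 2.
  transitivity (\sum_k \sum_k' \sum_i \sum_j l i * l j *
      ((u i ord0 k * u j ord0 k) * (u i ord0 k' * u j ord0 k'))).
    apply: eq_bigr => k _; apply: eq_bigr => k' _.
    rewrite expr2 mulr_suml; apply: eq_bigr => i _.
    rewrite mulr_sumr; apply: eq_bigr => j _; ring.
  under eq_bigr do rewrite exchange_big /=.
  rewrite exchange_big /=; apply: eq_bigr => i _.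
  under eq_bigr do rewrite exchange_big /=.
  rewrite exchange_big /=; apply: eq_bigr => j _.
  rewrite expr2 /dot [in RHS]mulr_suml mulr_sumr; apply: eq_bigr => k _.
  by rewrite mulr_sumr mulr_sumr; apply: eq_bigr.
have Mtr : \sum_k M k k = Q.
  rewrite -lQ exchange_big; apply: eq_bigr => i _.
  by rewrite /dot mulr_sumr.
have QT : Q ^+ 2 <= N%:R * (s * Q).
  rewrite -Mtr; apply: le_trans (sqr_sum_le _ _ _) _.
  rewrite ler_wpM2l // Mtr.
  apply: (@le_trans _ _ (\sum_k \sum_k' M k k' ^+ 2)).
    apply: ler_sum => k _; rewrite (bigD1 k) //= lerDl.
    by apply: sumr_ge0 => *; exact: sqr_ge0.
  rewrite MT -subr_ge0.
  (* Sum pair_ge0 over i and j; the linear terms vanish since the u_i balance. *)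
  have -> : s * Q = \sum_i \sum_j (l i * l j * dot (u i) (u j) * (Q - s)
                       + l i * l j * (s * Q)).
    under eq_bigr => i _.
      rewrite big_split /= -!mulr_suml -mulr_sumr l1 mulr1.
      under eq_bigr do rewrite -mulrA -dotZr.
      rewrite -mulr_sumr -dot_sumr lu /dot.
      under eq_bigr do rewrite mxE mulr0.
      rewrite big1_eq mulr0 mul0r add0r; over.
    by rewrite -mulr_suml l1 mul1r.
  rewrite -sumrB; apply: sumr_ge0 => i _; rewrite -sumrB.
  apply: sumr_ge0 => j _; apply: le_trans (pair_ge0 i j) _.
  by rewrite le_eqVlt; apply/orP; left; apply/eqP; ring.
have [->|Qn0] := eqVneq Q 0; first by rewrite mulr0 mulr_ge0.
have Qp : 0 < Q by rewrite lt_def Qn0.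
move: QT; rewrite expr2 mulrA ler_pM2r // /s; lra.
Qed.

Lemma continuous_sum (R : realType) (V : normedModType R) (X : topologicalType)
    (T : finType) (f : T -> X -> V) (x : X) :
  (forall i, {for x, continuous (f i)}) ->
  {for x, continuous (fun y => \sum_i f i y)}.
Proof.
move=> fc; apply: cvg_big => [|i _]; [exact: add_continuous|exact: fc].
Qed.

Definition simplex (R : realType) (m : nat) : set 'rV[R]_m :=
  [set l | (forall i, 0 <= l ord0 i) /\ \sum_i l ord0 i = 1].

Lemma simplex_compact (R : realType) (m : nat) : compact (simplex R m).
Proof.
have -> : simplex R m = [set l : 'rV[R]_m | forall i, l ord0 i \in `[0, 1]] `&`
    (fun l : 'rV[R]_m => \sum_i l ord0 i) @^-1` [set 1].
  apply/seteqP; split => l /= [l0 l1]; split => // i.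
    rewrite in_itv /= l0 -l1 (bigD1 i) //= lerDl.
    by apply: sumr_ge0 => *; exact: l0.
  by have := l0 i; rewrite in_itv => /andP[].
apply: compact_closedI.
  by apply: (@rV_compact R m (fun=> [set` `[0, 1]])) => _; exact: segment_compact.
apply: (iffLR (continuous_closedP _)); last exact: closed_eq.
by move=> l; apply: continuous_sum => i; exact: coord_continuous.
Qed.

(** Moving the maximiser [l] towards the vertex [j] by [t] changes the variance
    by [t (q - Q) - t ^ 2 q], where [q] is the squared distance from [p j] to
    the barycentre; this is nonpositive for all small [t] only if
    [q <= Q]. *)
Lemma max_variance_barycenter (R : realType) (N m : nat)
    (p : 'I_m.+1 -> 'rV[R]_N) :
  exists2 l, simplex R m.+1 l & let c := \sum_i l ord0 i *: p i in
    forall j, dot (p j - c) (p j - c) <=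
              \sum_i l ord0 i * dot (p i - c) (p i - c).
Proof.
pose A (l : 'rV[R]_m.+1) := \sum_i l ord0 i * dot (p i) (p i).
pose C (l : 'rV[R]_m.+1) := \sum_i l ord0 i *: p i.
pose phi l := A l - dot (C l) (C l).
have e0 j : simplex R m.+1 (delta_mx ord0 j).
  split=> [i|]; first by rewrite mxE eqxx /= ler0n.
  rewrite (bigD1 j) //= mxE !eqxx big1 ?addr0 // => i /negbTE ij.
  by rewrite mxE ij.
have coordMc b i : continuous (fun l : 'rV[R]_m.+1 => l ord0 i * b).
  by move=> l; apply: continuousM; [exact: coord_continuous|
    exact: cst_continuous].
have phic : continuous phi.
  have Cc k : continuous (fun l => C l ord0 k).
    have -> : (fun l => C l ord0 k) = fun l => \sum_i l ord0 i * p i ord0 k.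
      apply/funext => l; rewrite summxE; apply: eq_bigr => i _; by rewrite mxE.
    move=> l; apply: continuous_sum => i.
    exact: coordMc.
  move=> l; apply: continuousB; apply: continuous_sum => i.
    exact: coordMc.
  by apply: continuousM; exact: Cc.
have [] := EVT_max_rV (ex_intro _ _ (e0 ord0)) (@simplex_compact R m.+1)
  (continuous_subspaceT phic).
move=> l /set_mem lS lmax; exists l => // c j.
have [l0 l1] := lS.
have Csum : \sum_i l ord0 i * dot (p i) c = dot c c.
  rewrite [in RHS]/c dot_suml; apply: eq_bigr => i _; by rewrite dotZl.
set Q := \sum_i l ord0 i * dot (p i - c) (p i - c).
have QE : Q = A l - dot c c.
  rewrite /Q; under eq_bigr => i _.
    have -> : l ord0 i * dot (p i - c) (p i - c) = l ord0 i * dot (p i) (p i)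
      - 2 * (l ord0 i * dot (p i) c) + l ord0 i * dot c c.
      by rewrite !dotE (dotC c); ring.
    over.
  rewrite big_split sumrB /= -mulr_sumr Csum -mulr_suml l1 -/(A l); ring.
have Q0 : 0 <= Q by apply: sumr_ge0 => i _; rewrite mulr_ge0 ?dot_ge0.
set q := dot (p j - c) (p j - c).
(* Optimality of l against the segment from l to the vertex j. *)
have step t : 0 < t -> t <= 1 -> q - Q <= t * q.
  move=> t0 t1; pose l' := (1 - t) *: l + t *: delta_mx ord0 j.
  have sumE (V : lmodType R) (x : 'I_m.+1 -> V) :
      \sum_i l' ord0 i *: x i = (1 - t) *: (\sum_i l ord0 i *: x i) + t *: x j.
    rewrite scaler_sumr.
    under eq_bigr do rewrite !mxE eqxx /= scalerDl -scalerA.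
    rewrite big_split /=; congr (_ + _).
    rewrite (bigD1 j) //= eqxx mulr1 big1 ?addr0 // => i /negbTE ->.
    by rewrite mulr0 scale0r.
  have l'S : simplex R m.+1 l'.
    split=> [i|]; last first.
      have := sumE R^o (fun=> 1); rewrite /GRing.scale /=.
      under eq_bigr do rewrite mulr1.
      by under [in X in _ = X]eq_bigr do rewrite mulr1; rewrite l1 => ->; ring.
    by rewrite !mxE addr_ge0 // mulr_ge0 ?l0 ?subr_ge0 ?ler0n // ltW.
  have := lmax l' (mem_set l'S); rewrite {2}/phi -/(C l) -/c -QE.
  have CE : C l' = c + t *: (p j - c).
    by rewrite /C sumE -/c scalerBl scale1r scalerBr addrAC addrA.
  have AE : A l' = (1 - t) * A l + t * dot (p j) (p j).
    exact: (sumE R^o (fun i => dot (p i) (p i))).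
  have -> : phi l' = Q + t * (q - Q - t * q).
    rewrite /phi AE CE !dotE /q !dotE (dotC c (p j)).
    have -> : A l = Q + dot c c by rewrite QE subrK.
    ring.
  by rewrite gerDl pmulr_rle0 // subr_le0.
rewrite leNgt; apply/negP => Qq.
have qp : 0 < q by exact: le_lt_trans Q0 Qq.
(* At this t, the inequality of step reads q - Q <= (q - Q) / 2. *)
have := step ((q - Q) / (2 * q)).
rewrite divr_gt0 ?subr_gt0 ?mulr_gt0 // ler_pdivrMr ?mulr_gt0 //.
move=> /(_ isT) h; have : q - Q <= 1 * (2 * q) by lra.
move=> /h; rewrite invfM mulrA mulfVK ?gt_eqF //; lra.
Qed.

(** With the barycentre of maximal variance as origin and [E = D ^ 2], this is
    [balanced_radius_le]. *)
Lemma jung (R : realType) (N : nat) (s : seq 'rV[R]_N) (D : R) :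
  {in s &, forall u v, enorm (u - v) <= D} ->
  exists c, {in s, forall u,
    enorm (u - c) <= Num.sqrt (N%:R / (2 * N%:R + 2)) * D}.
Proof.
case: s => [|x s] sD; first by exists 0 => u; rewrite in_nil.
pose p (i : 'I_(size s).+1) := nth 0 (x :: s) i.
have pS i : p i \in x :: s by exact: mem_nth.
have D0 : 0 <= D by apply: le_trans (enorm_ge0 _) (sD _ _ (pS ord0) (pS ord0)).
have [l [l0 l1] lc] := @max_variance_barycenter _ _ _ p.
set c := \sum_i _ in lc; exists c => u us.
have K0 : (0 : R) < 2 * N%:R + 2 by have := ler0n R N; lra.
rewrite enorm_leP ?mulr_ge0 ?sqrtr_ge0 //.
rewrite exprMn sqr_sqrtr ?divr_ge0 // ?(ltW K0) // mulrAC.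
rewrite ler_pdivlMr // mulrC.
move: us => /(nthP 0)[i] is_ <-; have := lc (Ordinal is_).
rewrite -[p _]/(nth 0 (x :: s) i) => /(ler_wpM2l (ltW K0)) /le_trans; apply.
apply: (@balanced_radius_le _ _ _ (l ord0) (fun i => p i - c)) => //.
- under eq_bigr do rewrite scalerBr.
  by rewrite sumrB -scaler_suml l1 scale1r subrr.
- move=> j k; rewrite opprB addrA subrK -enorm_leP //.
  exact: sD.
Qed.

(** * Finite nets and interpolation *)

Lemma interval_net (R : realType) (a b h : R) : 0 < h ->
  exists s : seq R, forall t, a <= t <= b -> exists2 x, x \in s & `|t - x| < h.
Proof.
move=> h0; exists [seq a + h * i%:R | i <- iota 0 (Num.truncn ((b - a) / h)).+1].
move=> t /andP[at_ tb]; have th0 : 0 <= (t - a) / h.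
  by rewrite divr_ge0 ?subr_ge0 // ltW.
exists (a + h * (Num.truncn ((t - a) / h))%:R).
  apply/mapP; exists (Num.truncn ((t - a) / h)) => //.
  rewrite mem_iota add0n /= ltnS le_truncn //.
  by rewrite ler_pM2r ?invr_gt0 // lerD2r.
have /andP[le1 lt1] := truncn_itv th0.
have taE : t - a = h * ((t - a) / h) by rewrite mulrCA divff ?mulr1 // gt_eqF.
rewrite opprD addrA {1}taE -mulrBr normrM gtr0_norm // gtr_pMr //.
by rewrite ger0_norm ?subr_ge0 // ltrBlDl natr1.
Qed.

Lemma coord_le_enorm {R : realType} {N : nat} (u : 'rV[R]_N) k :
  `|u ord0 k| <= enorm u.
Proof.
rewrite -(@ler_pXn2r _ 2) ?nnegrE ?enorm_ge0 // sqr_enorm real_normK ?num_real //.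
rewrite /dot (bigD1 k) //= -expr2 lerDl.
by apply: sumr_ge0 => l _; rewrite -expr2 sqr_ge0.
Qed.

(** A product of [N] one-dimensional nets, with mesh [e / N.+1] so that the [N]
    coordinate errors add up to at most [e]. *)
Lemma ball_net (R : realType) (N : nat) (M e : R) : 0 < e ->
  exists s : seq 'rV[R]_N, forall v, enorm v <= M ->
    exists2 g, g \in s & enorm (v - g) <= e.
Proof.
move=> e0; have N0 : 0 < N.+1%:R :> R by [].
have [s sP] := @interval_net R (- M) M (e / N.+1%:R) (divr_gt0 e0 N0).
exists (codom (fun q : {ffun 'I_N -> 'I_(size s)} => \row_k s`_(q k))) => v vM.
have /choice[q qP] k : exists i : 'I_(size s), `|v ord0 k - s`_i| < e / N.+1%:R.
  have [|x xs vx] := sP (v ord0 k).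
    by rewrite -ler_norml (le_trans (coord_le_enorm v k)).
  have xi : (index x s < size s)%N by rewrite index_mem.
  by exists (Ordinal xi); rewrite nth_index.
exists (\row_k s`_(q k)).
  apply/codomP; exists [ffun k => q k]; apply/rowP => k; by rewrite !mxE ffunE.
apply: (@le_trans _ _ (N%:R * (e / N.+1%:R))).
  apply: enorm_le_coord => [|k]; first by rewrite divr_ge0 // ltW.
  by rewrite !mxE ltW.
by rewrite mulrCA ger_pMr // ler_pdivrMr // mul1r ler_nat.
Qed.

Section Interpolation.
Context {R : realType} {N m : nat} (h : R) (x : 'I_m -> R).

(** Tent functions, whose normalisation is a partition of unity wherever the
    nodes [x i] are [h]-dense.  Dividing by their sum avoids any
    assumption on how the nodes are arranged. *)
Definition hat (i : 'I_m) (t : R) : R := Num.max 0 (h - `|t - x i|).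

Definition interp (c : 'I_m -> 'rV[R]_N) (t : R) : 'rV[R]_N :=
  (\sum_i hat i t)^-1 *: \sum_i hat i t *: c i.

Lemma hat_ge0 i t : 0 <= hat i t.
Proof. by rewrite /hat le_max lexx. Qed.

Lemma hat_gt0 i t : (0 < hat i t) = (`|t - x i| < h).
Proof. by rewrite /hat lt_max ltxx subr_gt0. Qed.

Lemma hat_continuous i : continuous (hat i).
Proof.
move=> t; apply: (@continuous_max R _ (fun=> 0) (fun t => h - `|t - x i|)).
  exact: cst_continuous.
apply: continuousB; first exact: cst_continuous.
apply: continuous_comp; last exact: norm_continuous.
by apply: continuousB; [exact: id|exact: cst_continuous].
Qed.

Lemma sum_hat_gt0 t : (exists i, `|t - x i| < h) -> 0 < \sum_i hat i t.
Proof.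
move=> [i]; rewrite -hat_gt0 => ti; rewrite (bigD1 i) //=.
by rewrite ltr_pwDl // sumr_ge0 // => j _; exact: hat_ge0.
Qed.

Lemma interp_continuous c (A : set R) :
  (forall t, A t -> exists i, `|t - x i| < h) ->
  {within A, continuous (interp c)}.
Proof.
move=> Ax; apply: continuous_in_subspaceT => t /set_mem At.
apply: (@continuousZ R 'rV[R]_N R (fun t => (\sum_i hat i t)^-1)
  (fun t => \sum_i hat i t *: c i)).
  apply: continuousV; first by rewrite gt_eqF // sum_hat_gt0 //; exact: Ax.
  by apply: continuous_sum => i; exact: hat_continuous.
apply: continuous_sum => i; apply: continuousZ; first exact: hat_continuous.
exact: cst_continuous.
Qed.

Lemma enorm_interp_le c t v r : (exists i, `|t - x i| < h) ->
  (forall i, `|t - x i| < h -> enorm (v - c i) <= r) ->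
  enorm (v - interp c t) <= r.
Proof.
move=> /sum_hat_gt0 W0 vc; set W := \sum_i hat i t in W0.
have -> : v - interp c t = W^-1 *: \sum_i hat i t *: (v - c i).
  under eq_bigr do rewrite scalerBr.
  by rewrite sumrB -scaler_suml -/W scalerBr scalerA mulVf ?scale1r ?gt_eqF.
rewrite enormZ gtr0_norm ?invr_gt0 // mulrC ler_pdivrMr //.
apply: le_trans (enorm_sum _ _) _; rewrite mulr_sumr.
apply: ler_sum => i _; rewrite enormZ ger0_norm ?hat_ge0 // mulrC.
have := hat_ge0 i t; rewrite le_eqVlt => /predU1P[<-|]; first by rewrite !mulr0.
by move=> hi; rewrite ler_pM2r // vc // -hat_gt0.
Qed.
End Interpolation.

(** The centre of [f] on the [i]-th interval is computed from the set of net
    points that approximate values of [f] there.  There are finitely many such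
    sets, hence finitely many interpolants for the whole family.  The
    term [2 * e] is the growth of the diameter under rounding, the last [e] the
    distance from a value to its rounding. *)
Lemma finite_jung_net (R : realType) (N : nat) (a b M d w e : R)
    (F : set (R -> 'rV[R]_N)) : 0 < d -> 0 < e ->
  (forall f, F f -> forall x, a <= x <= b -> enorm (f x) <= M) ->
  (forall f, F f -> forall x y, a <= x <= b -> a <= y <= b -> `|x - y| < d ->
     enorm (f x - f y) <= w) ->
  exists F0, [/\ finite_set F0, F0 `<=` @Cab R N a b &
    forall f, F f -> exists2 g, F0 g & forall x, a <= x <= b ->
      enorm (f x - g x) <= Num.sqrt (N%:R / (2 * N%:R + 2)) * (w + 2 * e) + e].
Proof.
move=> d0 e0 FM Fw; set J := Num.sqrt _.
have [s sP] := @ball_net R N M e e0.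
have [xs xsP] := @interval_net R a b (d / 2) (divr_gt0 d0 (ltr0Sn _ 1)).
pose x (i : 'I_(size xs)) := xs`_i.
have xP t : a <= t <= b -> exists i, `|t - x i| < d / 2.
  move=> /xsP[y ys ty]; have yi : (index y xs < size xs)%N by rewrite index_mem.
  by exists (Ordinal yi); rewrite /x /= nth_index.
pose p (i : 'I_(size s)) := s`_i.
(* Sets of larger diameter never arise below; their centre is set to 0. *)
have /choice[cen cenP] (S : {set 'I_(size s)}) : exists c : 'rV[R]_N,
    {in S &, forall i j, enorm (p i - p j) <= w + 2 * e} ->
    {in S, forall i, enorm (p i - c) <= J * (w + 2 * e)}.
  have [Sd|Sd] := pselect {in S &, forall i j,
    enorm (p i - p j) <= w + 2 * e}; last by exists 0.
  have [|c cP] := @jung R N [seq p i | i in S] (w + 2 * e).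
    by move=> u v /fintype.imageP[i iS ->] /fintype.imageP[j jS ->]; exact: Sd.
  by exists c => _ i iS; apply: cP; apply: fintype.image_f.
exists (range (fun k : {ffun 'I_(size xs) -> {set 'I_(size s)}} =>
  interp (d / 2) x (fun i => cen (k i)))); split.
- exact: finite_image.
- move=> _ [k _ <-]; apply: interp_continuous => t /=.
  by rewrite in_itv => /xP.
move=> f Ff.
pose in_cell i y := a <= y <= b /\ `|y - x i| < d / 2.
pose S i : {set 'I_(size s)} :=
  [set j | `[< exists2 y, in_cell i y & enorm (f y - p j) <= e >]]%SET.
exists (interp (d / 2) x (fun i => cen ([ffun j => S j] i))).
  by exists [ffun i => S i].
move=> t tab; apply: enorm_interp_le => [|i ti]; first exact: xP.
rewrite ffunE; have [g gs tg] := sP _ (FM f Ff t tab).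
have gi : (index g s < size s)%N by rewrite index_mem.
have gE : p (Ordinal gi) = g by rewrite /p /= nth_index.
apply: le_trans (enorm_distD g _ _) _; rewrite addrC; apply: lerD => //.
rewrite -gE; apply: cenP => [j k|]; rewrite !inE; last first.
  by exists t => //; rewrite gE.
move=> [y [yab yi] yj] [z [zab zi] zk].
(* Two points of the same cell are at distance less than twice d / 2. *)
have yz : `|y - z| < d.
  rewrite -(subrK (x i) y) -addrA; apply: le_lt_trans (ler_normD _ _) _.
  by rewrite [ltRHS]splitr ltrD // distrC.
have := Fw f Ff y z yab zab yz.
have := enorm_distD (f y) (p j) (p k); have := enorm_distD (f z) (f y) (p k).
rewrite (enormB (p j) (f y)); lra.
Qed.

(** * Uniform equicontinuity *)

Lemma enorm_le_mx_norm {R : realType} {N : nat} (u : 'rV[R]_N) :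
  enorm u <= N%:R * `|u|.
Proof.
apply: enorm_le_coord => // k.
rewrite [leRHS]mx_normrE.
exact: (le_bigmax _ (fun ij => `|u ij.1 ij.2|) (ord0, k)).
Qed.

(** Heine's theorem, phrased with a filter of radii so that finitely many
    functions can share one radius. *)
Lemma near_equicontinuous (R : realType) (N : nat) (a b : R)
    (g : R -> 'rV[R]_N) (e : R) : 0 < e -> @Cab R N a b g ->
  \forall d \near 0^'+, forall x y, a <= x <= b -> a <= y <= b ->
    `|x - y| < d -> enorm (g x - g y) <= e.
Proof.
move=> e0 /subspace_continuousP gc.
have e1 : 0 < e / 2 / N.+1%:R by rewrite !divr_gt0.
have := @segment_compact R a b.
move=> /compact_near_coveringP/near_covering_withinP.
move=> /(_ R (0^'+) (fun d x => forall y, a <= y <= b ->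
    `|x - y| < d -> enorm (g x - g y) <= e) _) cov.
have {cov} : \forall d \near 0^'+, `[a, b] `<=` (fun x => forall y,
    a <= y <= b -> `|x - y| < d -> enorm (g x - g y) <= e).
  apply: cov => x xab.
  have /cvgrPdist_lt/(_ _ e1) := gc x xab.
  rewrite near_withinE => /nbhs_ballP[r /= r0 rP].
  have close y : a <= y <= b -> `|x - y| < r -> enorm (g x - g y) <= e / 2.
    move=> yab xy; apply: le_trans (enorm_le_mx_norm _) _.
    have /ltW h := rP y xy yab.
    apply: (@le_trans _ _ (N%:R * (e / 2 / N.+1%:R))); first exact: ler_wpM2l.
    by rewrite mulrCA ger_pMr ?divr_gt0 // ler_pdivrMr // mul1r ler_nat.
  exists ([set x' | `|x - x'| < r / 2], [set d | d < r / 2]) => /=.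
    split; first by apply: (@nbhsx_ballx _ R^o x (r / 2)); rewrite divr_gt0.
    by apply: nbhs_right_lt; rewrite divr_gt0.
  move=> [z d] /= [xz dr] zab y yab zy.
  have xz' : `|x - z| < r by lra.
  have xy : `|x - y| < r.
    by have := ler_normD (x - z) (z - y); rewrite addrA subrK; lra.
  have := close z zab xz'; have := close y yab xy.
  have := enorm_distD (g x) (g z) (g y); rewrite (enormB (g z) (g x)); lra.
apply: filterS => d H x y xab yab; apply: H => //=.
Qed.

Lemma finite_equicontinuous (R : realType) (N : nat) (a b : R)
    (F0 : set (R -> 'rV[R]_N)) (e : R) : 0 < e ->
  finite_set F0 -> F0 `<=` @Cab R N a b ->
  exists2 d, 0 < d & forall g, F0 g ->
    forall x y, a <= x <= b -> a <= y <= b ->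
    `|x - y| < d -> enorm (g x - g y) <= e.
Proof.
move=> e0 /finite_seqP[s ->] sC.
have near_good : \forall d \near 0^'+, forall i x y,
    a <= x <= b -> a <= y <= b -> `|x - y| < d ->
    enorm (tnth (in_tuple s) i x - tnth (in_tuple s) i y) <= e.
  apply: filter_forall => i; apply: near_equicontinuous => //.
  by apply: sC; exact: mem_tnth.
have near_pos : \forall d \near (0 : R)^'+, 0 < d by exact: nbhs_right_gt.
have [d [dP d0]] := filter_ex (filterI near_good near_pos).
by exists d => // g /(tnthP (in_tuple s))[i ->]; exact: dP.
Qed.

(** * The two inequalities *)

Lemma nnsup_leP {R : realType} {S : set (\bar R)} {x : \bar R} :
  (nnsup S <= x)%E <-> (0 <= x)%E /\ (forall y, S y -> (y <= x)%E).
Proof.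
split=> [/ereal_supP H|[x0 Sx]].
  by split=> [|y Sy]; apply: H; [left|right].
by apply/ereal_supP => y [->|/Sx].
Qed.

Lemma nnsup_ge0 {R : realType} (S : set (\bar R)) : (0 <= nnsup S)%E.
Proof. by have [] := nnsup_leP.1 (lexx (nnsup S)). Qed.

Lemma nnsup_ub {R : realType} {S : set (\bar R)} {y} : S y -> (y <= nnsup S)%E.
Proof. by move=> Sy; have [_] := nnsup_leP.1 (lexx (nnsup S)); apply. Qed.

Lemma half_mu_uec_le_mu_H (R : realType) (N : nat) (a b : R)
    (F : set (R -> 'rV[R]_N)) :
  ((2^-1)%:E * mu_uec a b F <= mu_H a b F)%E.
Proof.
apply/ereal_infP => _ [F0 [F0fin F0C] <-]; rewrite lee_pdivrMl //.
set S := nnsup _; have := nnsup_ge0 _ : (0 <= S)%E.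
case SE : S => [s| |] // s0; last by rewrite gt0_muley // leey.
(* The oscillation of f is at most 2 (s + e / 4) plus e / 4 for that of g. *)
apply/lee_addgt0Pr => e e0; have e4 : 0 < e / 4 by rewrite divr_gt0.
have [d d0 dP] := @finite_equicontinuous R N a b F0 _ e4 F0fin F0C.
apply: ge_ereal_inf; eexists; first by exists d.
rewrite -EFinM -EFinD; apply/nnsup_leP; split.
  by rewrite lee_fin addr_ge0 ?mulr_ge0 // ltW.
move=> _ [f Ff <-]; apply/nnsup_leP; split.
  by rewrite lee_fin addr_ge0 ?mulr_ge0 // ltW.
move=> _ [[x y] /= [xab yab xy] <-]; rewrite lee_fin.
have : (ereal_inf [set supnorm a b (fun x => (f x - g x)%R) | g in F0] <
    (s + e / 4)%:E)%E.
  apply: (@le_lt_trans _ _ s%:E); last by rewrite lte_fin ltrDl.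
  by rewrite -SE; apply: nnsup_ub; exists f.
move=> /ereal_inf_lt[_ [g F0g <-] /ltW/nnsup_leP[_ fg]].
have close t : t \in `[a, b] -> enorm (f t - g t) <= s + e / 4.
  by move=> tab; rewrite -lee_fin; apply: fg; exists t.
have := close x xab; have := close y yab.
rewrite !in_itv in xab yab.
have := dP g F0g x y xab yab xy.
have := enorm_distD (g x) (f x) (f y); have := enorm_distD (g y) (g x) (f y).
rewrite (enormB (g y) (f y)); lra.
Qed.

Lemma mu_H_le_jung (R : realType) (N : nat) (a b : R)
    (F : set (R -> 'rV[R]_N)) : (1 <= N)%N -> uniformly_bounded a b F ->
  (mu_H a b F <= (Num.sqrt (N%:R / (2 * N%:R + 2)))%:E * mu_uec a b F)%E.
Proof.
move=> N1 [M [M0 FM]]; set J := Num.sqrt _.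
have J0 : 0 < J.
  have N0 : (0 : R) < N%:R by rewrite ltr0n.
  by rewrite sqrtr_gt0 divr_gt0 // addr_gt0 // mulr_gt0.
rewrite -lee_pdivrMl //; apply/ereal_infP => _ [d /= d0 <-].
rewrite lee_pdivrMl //.
set S := nnsup _; have := nnsup_ge0 _ : (0 <= S)%E.
case SE : S => [w| |] // w0; last by rewrite gt0_muley ?lte_fin // leey.
apply/lee_addgt0Pr => e e0.
(* With this e', the total error 2 J e' + e' of the net is e. *)
pose e' := e / (2 * J + 1).
have e'0 : 0 < e' by rewrite divr_gt0 // addr_gt0 // mulr_gt0.
have Fw f : F f -> forall x y, a <= x <= b -> a <= y <= b -> `|x - y| < d ->
    enorm (f x - f y) <= w.
  move=> Ff x y xab yab xy; rewrite -lee_fin -SE.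
  apply: (le_trans _ (nnsup_ub _)); last by exists f.
  by apply: nnsup_ub; exists (x, y) => //=; rewrite !in_itv.
have FM' f : F f -> forall x, a <= x <= b -> enorm (f x) <= M.
  by move=> Ff x xab; apply: FM => //; rewrite in_itv.
have [F0 [F0fin F0C F0P]] := @finite_jung_net R N a b M d w e' F d0 e'0 FM' Fw.
apply: ge_ereal_inf; eexists; first by exists F0.
have ge0 : (0 <= J%:E * w%:E + e%:E)%E.
  by rewrite -EFinM -EFinD lee_fin addr_ge0 ?mulr_ge0 // ltW.
apply/nnsup_leP; split=> // _ [f Ff <-].
have [g F0g fg] := F0P f Ff.
apply: ge_ereal_inf; eexists; first by exists g.
apply/nnsup_leP; split=> // _ [x /= xab <-].
rewrite -EFinM -EFinD lee_fin.
apply: le_trans (fg x _) _; first by move: xab; rewrite in_itv.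
have -> : e = e' * (2 * J + 1).
  by rewrite divfK // gt_eqF // addr_gt0 // mulr_gt0.
by rewrite -/J; lra.
Qed.

Theorem theorem1p2 (R : realType) (N : nat) (hN : (1 <= N)%N) (a b : R)
    (hab : a < b) (F : set (R -> 'rV[R]_N)) (hF : F `<=` @Cab R N a b)
    (hbdd : uniformly_bounded a b F) :
  [/\ ((2^-1)%:E * mu_uec a b F <= mu_H a b F)%E,
      (mu_H a b F <=
         (Num.sqrt (N%:R / (2 * N%:R + 2)))%:E * mu_uec a b F)%E
    & N = 1%N -> mu_H a b F = ((2^-1)%:E * mu_uec a b F)%E].
Proof.
have lower := half_mu_uec_le_mu_H R N a b F.
have upper := mu_H_le_jung R N a b F hN hbdd.
split=> // N1; apply/le_anti; rewrite lower andbT.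
suff -> : 2^-1 = Num.sqrt (N%:R / (2 * N%:R + 2)) :> R by [].
rewrite N1; have -> : 1%:R / (2 * 1%:R + 2) = (2^-1) ^+ 2 :> R by field.
by rewrite sqrtr_sqr ger0_norm.
Qed.
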